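(* Let $a,b$ be positive integers, let $p$ be an integer relatively prime to $a$, and let $a_1,\dots,a_n$ be integers with $a_i\equiv 0 \pmod a$ for every $i$. Then $$R_2(px+a_1x_1+a_2x_2+\cdots+a_nx_n=abz)\ge a^2,$$ where $x,x_1,\dots,x_n,z$ are the variables of the equation.
   Context: For a positive integer $N$ let $[N]=\{1,\dots,N\}$. For a linear homogeneous equation $\mathcal{E}$ with integer coefficients and a positive integer $c$, the Rado number $R_c(\mathcal{E})$ is the least positive integer $N$ such that every $c$-coloring of $[N]$ contains a monochromatic solution to $\mathcal{E}$, i.e. a solution whose variables all take values in $[N]$ (not necessarily distinct) having the same color. If no such $N$ exists, $R_c(\mathcal{E})=\infty$. *)

(* Defs.v *)
From mathcomp Require Import all_boot all_order all_algebra.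
From mathcomp Require Import boolp constructive_ereal.

Set Implicit Arguments.
Unset Strict Implicit.
Unset Printing Implicit Defensive.

Import Order.TTheory GRing.Theory Num.Theory.

Local Open Scope ring_scope.

(* The equation e_0 x_0 + ... + e_(m-1) x_(m-1) = 0 is given by its tuple of
   coefficients e.  The element i : 'I_N stands for the integer i + 1 of [N]. *)
Definition is_solution (m N : nat) (e : m.-tuple int) (x : {ffun 'I_m -> 'I_N})
    : bool :=
  \sum_(i < m) tnth e i * (x i).+1%:Z == 0.

Definition monochromatic (m N c : nat) (col : {ffun 'I_N -> 'I_c})
    (x : {ffun 'I_m -> 'I_N}) : bool :=
  [exists k, forall i, col (x i) == k].

Definition rado_property (c m : nat) (e : m.-tuple int) (N : nat) : bool :=
  [forall col : {ffun 'I_N -> 'I_c},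
     exists x : {ffun 'I_m -> 'I_N}, is_solution e x && monochromatic col x].

Definition rado_number (c m : nat) (e : m.-tuple int) : \bar int :=
  if pselect (exists N, (0 < N)%N && rado_property c e N) is left exN
  then (ex_minn exN)%:Z%:E else +oo%E.

(* Main.v *)
(* Reducing modulo a shows that a divides x in every solution.  Color [N] by
   divisibility by a: in a monochromatic solution all variables are then
   multiples of a, and dividing them by a gives another solution, so a ^ 2
   divides x, which is impossible when N < a ^ 2. *)
Require Import Defs.
From mathcomp Require Import all_boot all_order all_algebra.
From mathcomp Require Import boolp constructive_ereal.

Set Implicit Arguments.
Unset Strict Implicit.
Unset Printing Implicit Defensive.

Import Order.TTheory GRing.Theory Num.Theory.

Local Open Scope ring_scope.

(** All terms but the head are multiples of [a], so [a] divides the head term and Gauss's lemma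
    applies. The [y i] are arbitrary integers, so that this serves both a solution and its quotient
    by [a]. *)
Lemma dvdz_head_solution (m : nat) (a : int) (e : m.+1.-tuple int)
    (y : 'I_m.+1 -> int) :
    coprimez (tnth e ord0) a ->
    (forall i, (a %| tnth e (lift ord0 i))%Z) ->
  \sum_(i < m.+1) tnth e i * y i = 0 -> (a %| y ord0)%Z.
Proof.
move=> co_ea dvd_ae; rewrite big_ord_recl => /eqP; rewrite addr_eq0 => /eqP sol.
rewrite coprimez_sym in co_ea.
rewrite -(Gauss_dvdzr _ co_ea) sol dvdzE abszN -dvdzE.
by apply: rpred_sum => i _; apply: dvdz_mulr.
Qed.

Lemma rado_property_ge (m N a : nat) (e : m.+1.-tuple int) :
    (0 < a)%N -> coprimez (tnth e ord0) a%:Z ->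
    (forall i, (a%:Z %| tnth e (lift ord0 i))%Z) ->
  rado_property 2 e N -> (a ^ 2 <= N)%N.
Proof.
move=> a_gt0 co_ea dvd_ae.
move=> /forallP/(_ [ffun i : 'I_N => if (a %| i.+1)%N then ord0 else ord_max]).
case/existsP=> x /andP[/eqP sol /existsP[k /forallP mono]].
have dvd_x0 : (a %| (x ord0).+1)%N := dvdz_head_solution co_ea dvd_ae sol.
have dvd_x i : (a %| (x i).+1)%N.
  have /eqP := mono i; have /eqP <- := mono ord0.
  (* A non-multiple would have color [ord_max], distinct from [ord0] in ['I_2]. *)
  by rewrite !ffunE dvd_x0; case: ifP.
have sol' : \sum_(i < m.+1) tnth e i * ((x i).+1 %/ a)%N%:Z = 0.
  have a_neq0 : a%:Z != 0 by rewrite eqz_nat -lt0n.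
  apply: (mulIf a_neq0); rewrite mul0r -[RHS]sol mulr_suml.
  by apply: eq_bigr => i _; rewrite -mulrA -PoszM divnK.
have dvd_q : (a %| (x ord0).+1 %/ a)%N := dvdz_head_solution co_ea dvd_ae sol'.
rewrite dvdn_divRL // mulnn in dvd_q.
(* The multiple [(x ord0).+1] of [a ^ 2] is positive, and at most [N] since [x ord0 < N]. *)
exact: leq_trans (dvdn_leq _ dvd_q) (ltn_ord _).
Qed.

Theorem theorem3p5 (n a b : nat) (p : int) (A : n.-tuple int)
    (a_gt0 : (0 < a)%N) (b_gt0 : (0 < b)%N) (co_pa : coprimez p a%:Z)
    (A_mod : forall i : 'I_n, (tnth A i = 0 %[mod a%:Z])%Z) :
  (((a ^ 2)%N%:Z)%:E <=
     rado_number 2 [tuple of p :: rcons A (- (a%:Z * b%:Z))%R])%E.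
Proof.
rewrite /rado_number; case: pselect => [exN|_]; last exact: leey.
rewrite lee_fin lez_nat; case: ex_minnP => N /andP[_ radoN] _.
apply: rado_property_ge radoN => // i.
rewrite (tnth_nth 0) /= nth_rcons size_tuple.
case: ltnP => [lt_in|_].
  by rewrite -(tnth_nth 0 A (Ordinal lt_in)); apply/dvdz_mod0P; rewrite A_mod mod0z.
(* Past [A] comes either the coefficient of [z] or the default [0] of [nth]. *)
by case: ifP => _; rewrite ?dvdz0 // dvdzE abszN -dvdzE dvdz_mulr.
Qed.
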